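(* Consider the following groups of order $2^n$: $$D_{2^n}=\langle x,y\mid x^{2^{n-1}}=1,\ y^2=1,\ yxy=x^{-1}\rangle\quad(n\ge 2),$$ $$Q_{2^n}=\langle x,y\mid x^{2^{n-1}}=1,\ y^2=x^{2^{n-2}},\ yxy^{-1}=x^{-1}\rangle\quad(n\ge 3),$$ $$QD_{2^n}=\langle x,y\mid x^{2^{n-1}}=1,\ y^2=1,\ yxy=x^{r}\rangle,\ r=2^{n-2}-1\quad(n\ge 4).$$ Then, for $n$ in the respective ranges: 1. $\mathcal{V}(D_{2^n})=\dfrac{2^{n-1}+1}{2^n+n-1}$; 2. $\mathcal{V}(Q_{2^n})=\dfrac{1}{2^{n-1}+n-1}$; 3. $\mathcal{V}(QD_{2^n})=\dfrac{2^{n-2}+1}{3\cdot 2^{n-2}+n-1}$.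
   Context: For a finite group $G$, $L(G)$ denotes the set of all subgroups of $G$ (including the trivial subgroup and $G$ itself), $s(G)$ denotes the number of subgroups of $G$ that are simple groups (the trivial group is not simple; cyclic groups of prime order are simple), and $\mathcal{V}(G)=s(G)/|L(G)|$. Subgroups are counted as subsets of $G$. *)

(* Defs.v *)
From mathcomp Require Import all_boot all_order all_fingroup all_algebra.
From mathcomp Require Import all_solvable.

Set Implicit Arguments.
Unset Strict Implicit.
Unset Printing Implicit Defensive.

Import GRing.Theory.
Local Open Scope group_scope.

(* [simple] (from gseries) excludes the trivial group, and two elements of
   {group gT} are equal exactly when their underlying sets are. *)
Definition num_simple_subgroups (gT : finGroupType) (G : {group gT}) : nat :=
  #|[set H in subgroups G | simple H]|.

Definition simple_ratio (gT : finGroupType) (G : {group gT}) : rat :=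
  ((num_simple_subgroups G)%:R / #|subgroups G|%:R)%R.

(* [G \isog Grp (...)] characterizes the largest finite quotient of the
   presented group; the three presented groups are finite (every element is
   x^i y^j with i < 2^(n-1), j < 2), so it means that G is isomorphic to the
   presented group itself. *)
Definition dihedral2 (n : nat) (gT : finGroupType) (G : {group gT}) : Prop :=
  G \isog Grp (x : y : x ^+ (2 ^ (n - 1))%N, y ^+ 2, y * x * y = x^-1).

Definition quaternion2 (n : nat) (gT : finGroupType) (G : {group gT}) : Prop :=
  G \isog Grp (x : y : x ^+ (2 ^ (n - 1))%N, y ^+ 2 = x ^+ (2 ^ (n - 2))%N,
                       y * x * y^-1 = x^-1).

Definition quasidihedral2 (n : nat) (gT : finGroupType) (G : {group gT}) :
    Prop :=
  G \isog Grp (x : y : x ^+ (2 ^ (n - 1))%N, y ^+ 2,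
                       y * x * y = x ^+ (2 ^ (n - 2) - 1)%N).

(* The presentations agree with the library's models of these groups, which
   have order 2^n (card_2dihedral, card_quaternion, card_semidihedral). *)
Lemma isoGrp_isog (gT rT : finGroupType) (G : {group gT}) (H : {group rT}) p :
  H \isog Grp p -> (G \isog Grp p) <-> G \isog H.
Proof.
move=> isoH; split=> [isoG | isoGH]; last exact: isoGrp_trans isoGH isoH.
by rewrite isogEhom isoH isoG !isoGrp_hom.
Qed.

Lemma eq_conj_rel (gT : finGroupType) (x y z : gT) :
  y ^+ 2 = 1 -> (y * x * y == z) = (x ^ y == z).
Proof.
move=> y2; have yV: y^-1 = y by apply/eqP; rewrite eq_invg_mul -y2.
by rewrite conjgE yV mulgA.
Qed.

Lemma dihedral2P (n : nat) (gT : finGroupType) (G : {group gT}) :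
  2 <= n -> dihedral2 n G <-> G \isog 'D_(2 ^ n).
Proof.
move=> n_gt1; apply: isoGrp_isog => rT H; rewrite Grp_2dihedral //.
apply: eq_existsb => [[x y]] /=; rewrite !xpair_eqE !subn1.
do 2!congr (_ && _); apply: andb_id2l => /eqP y2.
by rewrite (eq_conj_rel _ _ y2).
Qed.

Lemma quaternion2P (n : nat) (gT : finGroupType) (G : {group gT}) :
  3 <= n -> quaternion2 n G <-> G \isog 'Q_(2 ^ n).
Proof.
move=> n_gt2; apply: isoGrp_isog => rT H; rewrite Grp_quaternion //.
apply: eq_existsb => [[x y]] /=; rewrite !xpair_eqE subn1 subn2.
do 3!congr (_ && _); rewrite conjgE; apply/eqP/eqP=> xy.
  have xE: x = y^-1 * (x^-1 * y).
    by apply: invg_inj; rewrite -{1}xy !invMg !invgK ?mulgA.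
  by rewrite {1}xE mulKVg mulgK.
have xE: x = y * x^-1 * y^-1.
  by apply: invg_inj; rewrite -{1}xy !invMg !invgK ?mulgA.
by rewrite {1}xE mulgKV mulKg.
Qed.

Lemma quasidihedral2P (n : nat) (gT : finGroupType) (G : {group gT}) :
  4 <= n -> quasidihedral2 n G <-> G \isog 'SD_(2 ^ n).
Proof.
move=> n_gt3; apply: isoGrp_isog => rT H; rewrite Grp_semidihedral //.
apply: eq_existsb => [[x y]] /=; rewrite !xpair_eqE !subn1 subn2.
do 2!congr (_ && _); apply: andb_id2l => /eqP y2.
by rewrite (eq_conj_rel _ _ y2).
Qed.

(* Main.v *)
(** All three groups [G] have a cyclic subgroup [X] of order [2 ^ (n - 1)] and
    index 2 such that [z ^+ 4 = 1] for every [z] in [G :\: X]. A subgroup [H]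
    not inside [X] is the union of [K := H :&: X] and a coset [K * z] with
    [z ^+ 2 \in K], so the number of such [H] over a given [K] is
    [#|{z in G :\: X | z ^+ 2 \in K}| / #|K|]. If [K] is nontrivial it contains
    the involution of [X], so the numerator is [2 ^ (n - 1)]; if [K = 1] it is
    the number [m] of involutions outside [X]. Summing over the [n] subgroups
    of [X] gives [n + m + 2 ^ (n - 1) - 1] subgroups, of which [m + 1] have
    order 2; here [m] is [2 ^ (n - 1)], [0] and [2 ^ (n - 2)] respectively. *)

Require Import Defs.
From mathcomp Require Import all_boot all_order all_fingroup all_algebra.
From mathcomp Require Import all_solvable.
From mathcomp Require Import ring.

Set Implicit Arguments.
Unset Strict Implicit.
Unset Printing Implicit Defensive.

(** * Subgroups of cyclic groups of prime power order *)

Section CyclicSubgroups.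

Local Open Scope group_scope.

(** A cyclic group has exactly one subgroup of each order dividing its own; [h k], generated by
    [x ^+ (p ^ (e - k))], is the one of order [p ^ k]. *)
Lemma sum_subgroups_cyclic_pgroup (gT : finGroupType) (X : {group gT})
    (p e : nat) (F : nat -> nat) :
  prime p -> cyclic X -> #|X| = (p ^ e)%N ->
  (\sum_(K in subgroups X) F #|K| = \sum_(k < e.+1) F (p ^ k)%N)%N.
Proof.
move=> p_pr cX oX; have /cyclicP[x defX] := cX.
have ox : #[x] = (p ^ e)%N by rewrite orderE -defX.
pose h (k : 'I_e.+1) : {group gT} := <[x ^+ (p ^ (e - k))]>%G.
have oh k : #|h k| = (p ^ k)%N.
  by rewrite -[LHS]/#[_] (orderXexp _ ox) subKn // -ltnS.
have hX k : h k \subset X by rewrite cycle_subG defX mem_cycle.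
have injh : injective h.
  move=> i j /(congr1 (fun K : {group gT} => #|K|)); rewrite !oh => /eqP.
  by rewrite eqn_exp2l ?prime_gt1 // => /eqP /val_inj.
have -> : subgroups X = [set h k | k in 'I_e.+1].
  apply/setP=> K; rewrite inE; apply/idP/imsetP=> [sKX | [k _ ->]]; last exact: hX.
  have := cardSg sKX; rewrite oX => /(dvdn_pfactor _ _ p_pr)[k le_ke oK].
  have lt_k : (k < e.+1)%N by [].
  exists (Ordinal lt_k) => //; apply/val_inj/eqP.
  by rewrite (eq_subG_cyclic cX) ?hX // oh oK.
rewrite big_imset => [|i j _ _ /injh //].
by apply: eq_bigr => k _; rewrite oh.
Qed.

Lemma card_subgroups_cyclic_pgroup (gT : finGroupType) (X : {group gT})
    (p e : nat) :
  prime p -> cyclic X -> #|X| = (p ^ e)%N -> #|subgroups X| = e.+1.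
Proof.
move=> p_pr cX oX; rewrite -sum1_card.
rewrite (sum_subgroups_cyclic_pgroup (fun=> 1%N) p_pr cX oX) //.
by rewrite sum1_card card_ord.
Qed.

End CyclicSubgroups.

(** Reduces counting simple subgroups of a 2-group to counting subgroups of order 2. *)
Lemma simple_solE (gT : finGroupType) (G : {group gT}) :
  solvable G -> simple G = prime #|G|.
Proof.
move=> solG; apply/idP/idP=> [|prG]; first exact: simple_sol_prime.
apply/simpleP; split=> [|H /normal_sub sHG].
  by rewrite trivg_card1; case: eqP prG => // ->.
have /primeP[_ /(_ _ (cardSg sHG)) /orP[oH | oH]] := prG.
  by left; apply/eqP; rewrite trivg_card1.
by right; apply/eqP; rewrite eqEcard sHG (eqP oH) /=.
Qed.

(** * Subgroups not contained in a subgroup of index 2 *)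

Section Index2.

Local Open Scope group_scope.

Variables (gT : finGroupType) (G X : {group gT}).
Hypotheses (sXG : X \subset G) (iX : #|G : X| = 2).

(** Prime index makes [X] maximal, so [X * H = G], and the product formula gives the order. *)
Lemma card_not_sub_index2 (H : {group gT}) :
  H \subset G -> ~~ (H \subset X) -> #|H| = (2 * #|H :&: X|)%N.
Proof.
move=> sHG nsHX; have nsXG := index2_normal sXG iX.
have maxX : maximal X G.
  by apply: p_index_maximal => //; rewrite iX.
have defG := mulg_normal_maximal nsXG maxX sHG nsHX.
have := mul_cardG X H; rewrite defG -(Lagrange sXG) iX -mulnA.
by move/eqP; rewrite eqn_pmul2l ?cardG_gt0 // setIC => /eqP.
Qed.

Lemma sqr_index2 (z : gT) : z \in G -> z ^+ 2 \in X.
Proof.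
move=> Gz; have nsXG := index2_normal sXG iX.
have Nz := subsetP (normal_norm nsXG) z Gz.
rewrite coset_idr ?groupX // morphX //; apply/eqP.
rewrite -order_dvdn -[2]iX -card_quotient ?normal_norm //.
by rewrite order_dvdG // mem_quotient.
Qed.

(* A subgroup [H] not inside [X] with [H :&: X = K] is generated by [K] and
   any one of the [#|K|] elements of [H :\: X]; conversely [z] outside [X]
   extends [K] in this way exactly when [z ^+ 2 \in K]. *)
Lemma card_subgroups_index2 (K : {group gT}) :
    K \subset X -> K <| G ->
  (#|[set H in subgroups G | ~~ (H \subset X) && (H :&: X == K)]| * #|K|
     = #|[set z in G :\: X | z ^+ 2 \in K]|)%N.
Proof.
move=> sKX nsKG; set S := [set H in _ | _]; set A := [set z in _ | _].
pose f z := (K <*> <[z]>)%G.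
have sf z : z \in A -> f z \subset G.
  case/setIdP=> /setDP[Gz _] _.
  by rewrite join_subG cycle_subG Gz (subset_trans sKX sXG).
have nsf z : z \in A -> ~~ (f z \subset X).
  case/setIdP=> /setDP[_ Xz] _; apply: contra Xz => /subsetP; apply.
  by rewrite mem_gen // inE cycle_id orbT.
have fX z : z \in A -> f z :&: X = K.
  move=> Az; have /setIdP[/setDP[Gz Xz] z2K] := Az.
  have nKz : <[z]> \subset 'N(K).
    by rewrite cycle_subG (subsetP (normal_norm nsKG)).
  rewrite /= norm_joinEr // -group_modl //; apply/mulGSid.
  (* By the modular law only powers of [z] lying in [X] matter: an even power is a power of
     [z ^+ 2], hence in [K], and an odd one would force [z \in X]. *)
  apply/subsetP=> _ /setIP[/cycleP[i ->]].
  rewrite -(odd_double_half i) expgD -mul2n expgM.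
  have Kzi : (z ^+ 2) ^+ i./2 \in K by rewrite groupX.
  case: (odd i); last by rewrite mul1g.
  by rewrite expg1 groupMr ?(negPf Xz) // (subsetP sKX).
have fS z : z \in A -> f z \in S.
  by move=> Az; rewrite !inE sf // nsf //= fX.
have fibre H : H \in S -> [set z in A | f z == H] = H :\: X.
  rewrite !inE => /and3P[sHG nsHX /eqP HX].
  apply/setP=> z; apply/setIdP/setDP=> [[Az /eqP <-] | [Hz Xz]].
    have /setIdP[/setDP[_ Xz] _] := Az.
    by split=> //; rewrite mem_gen // inE cycle_id orbT.
  have Gz := subsetP sHG z Hz.
  have Az : z \in A by rewrite !inE Xz Gz -HX inE groupX // sqr_index2.
  (* [f z] lies in [H], and both have order [2 * #|K|]. *)
  split=> //; rewrite -val_eqE eqEcard /=.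
  rewrite join_subG cycle_subG Hz -{1}HX subsetIl /=.
  by rewrite (card_not_sub_index2 (sf z Az) (nsf z Az)) fX //
             (card_not_sub_index2 sHG nsHX) HX.
rewrite -[RHS]sum1_card (partition_big f (mem S)) //= -sum_nat_const.
apply: eq_bigr => H SH; rewrite sum1dep_card fibre // cardsD.
move: SH; rewrite !inE => /and3P[sHG nsHX /eqP HX].
by rewrite (card_not_sub_index2 sHG nsHX) HX mul2n -addnn addnK.
Qed.

End Index2.

(** * Counting in a 2-group with a cyclic subgroup of index 2 *)

Section CyclicMaximal.

Local Open Scope group_scope.

Variables (gT : finGroupType) (G X : {group gT}) (n : nat).
Hypotheses (n_gt1 : (1 < n)%N) (oG : #|G| = (2 ^ n)%N).
Hypotheses (sXG : X \subset G) (cX : cyclic X) (oX : #|X| = (2 ^ n.-1)%N).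
Hypothesis X'4 : {in G :\: X, forall z, z ^+ 4 = 1}.

Let m := #|[set z in G :\: X | z ^+ 2 == 1]|.
Let E K := [set H in subgroups G | ~~ (H \subset X) && (H :&: X == K)].

Let def_n : n = n.-1.+1. Proof. by case: n n_gt1. Qed.

Let iX : #|G : X| = 2.
Proof. by rewrite -divgS // oG oX {1}def_n expnS mulnK ?expn_gt0. Qed.

Let nsKG (K : {group gT}) : K \subset X -> K <| G.
Proof.
move=> sKX; apply: char_normal_trans (index2_normal sXG iX).
by rewrite sub_cyclic_char.
Qed.

Let card_E1 : #|E 1| = m.
Proof.
have := card_subgroups_index2 sXG iX (sub1G X) (nsKG (sub1G X)).
rewrite cards1 muln1 => ->.
by apply: eq_card => z; rewrite !inE.
Qed.

Let card_E (K : {group gT}) :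
  K \subset X -> (1 < #|K|)%N -> #|E K| = (2 ^ n.-1 %/ #|K|)%N.
Proof.
move=> sKX K_gt1; have evenK : 2 %| #|K|.
  have := cardSg sKX; rewrite oX => /(@dvdn_pfactor 2 _ _ isT)[[|k] _ oK].
    by rewrite oK in K_gt1.
  by rewrite oK expnS dvdn_mulr.
apply/eqP; rewrite eqn_div ?cardG_gt0 //; last by rewrite -oX cardSg.
rewrite card_subgroups_index2 ?nsKG //.
(* The order of [z ^+ 2] divides 2, hence [#|K|]; in the cyclic group [X] this divisibility already
   gives [<[z ^+ 2]> \subset K]. *)
have -> : [set z in G :\: X | z ^+ 2 \in K] = G :\: X.
  apply/setP=> z; rewrite inE andbC; case X'z: (z \in G :\: X); rewrite ?andbF //.
  have /setDP[Gz _] := X'z.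
  rewrite -cycle_subG -(cardSg_cyclic cX) ?cycle_subG //; last exact: (sqr_index2 sXG iX).
  by rewrite andbT (dvdn_trans _ evenK) // order_dvdn -expgM X'4.
by rewrite cardsD (setIidPr sXG) oG oX {1}def_n expnS mul2n -addnn addnK.
Qed.

Let sum_pow2 e : (\sum_(k < e) 2 ^ (e - k.+1) = 2 ^ e - 1)%N.
Proof.
rewrite (reindex_inj rev_ord_inj) /=.
under eq_bigr => k _ do rewrite subnSK ?ltn_ord // subKn 1?ltnW //.
by rewrite subn1 predn_exp mul1n.
Qed.

Lemma card_subgroups_cyclic_index2 : #|subgroups G| = (n + m + 2 ^ n.-1 - 1)%N.
Proof.
pose B := [set H : {group gT} | H \subset X].
rewrite -(cardsID B).
have -> : subgroups G :&: B = subgroups X.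
  by apply/setP=> H; rewrite !inE andb_idl // => /subset_trans->.
rewrite (card_subgroups_cyclic_pgroup _ cX oX) // -def_n.
rewrite -sum1_card.
rewrite (partition_big (fun H : {group gT} => (H :&: X)%G)
           (mem (subgroups X))) /=; last first.
  by move=> H _; rewrite inE subsetIr.
(* [#|E K|] depends on [#|K|] alone, so the sum over [K] becomes a sum over exponents; its first
   term, the trivial [K], is [m], and the others form a geometric sum. *)
pose F k := if k == 1%N then m else (2 ^ n.-1 %/ k)%N.
rewrite (eq_bigr (fun K : {group gT} => F #|K|)); last first.
  move=> K; rewrite inE => sKX.
  have -> : F #|K| = #|E K|.
    rewrite /F; case: eqP => [/eqP | /eqP oK].
      by rewrite -trivg_card1 => /eqP ->; rewrite card_E1.
    by rewrite card_E // ltn_neqAle eq_sym oK cardG_gt0.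
  rewrite sum1dep_card; apply: eq_card => H.
  by rewrite !inE -val_eqE /= -andbA andbCA.
rewrite (sum_subgroups_cyclic_pgroup _ _ cX oX) // big_ord_recl /= {1}/F /=.
rewrite -addnA -addnBA ?addn_gt0 ?expn_gt0 ?orbT // -addnBA ?expn_gt0 //.
do 2!congr (_ + _)%N.
rewrite -sum_pow2; apply: eq_bigr => k _; rewrite /F /bump /= add1n.
by rewrite gtn_eqF ?(ltn_exp2l 0) // -expnB.
Qed.

Lemma num_simple_subgroups_cyclic_index2 : num_simple_subgroups G = m.+1.
Proof.
have pG : 2.-group G by rewrite /pgroup oG pnatX.
have simple2 (H : {group gT}) : H \subset G -> simple H = (#|H| == 2).
  move=> sHG; have pH := pgroupS sHG pG; rewrite (simple_solE (pgroup_sol pH)).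
  apply/idP/eqP => [prH | -> //].
  by have /pgroupP/(_ _ prH (dvdnn _)) := pH; rewrite inE => /eqP.
rewrite /num_simple_subgroups.
have -> : [set H in subgroups G | simple H] = [set H in subgroups G | #|H| == 2].
  by apply/setP=> H; rewrite !inE; apply: andb_id2l => /simple2.
(* A subgroup of order 2 outside [X] meets [X] trivially, so these number [#|E 1| = m]; [X] itself
   contains just one. *)
rewrite -(cardsID [set H : {group gT} | H \subset X]) -[RHS]add1n.
congr (_ + _)%N; last first.
  rewrite -card_E1; apply: eq_card => H; rewrite !inE andbC -andbA.
  apply: andb_id2l => sHG; rewrite andbC; apply: andb_id2l => nsHX.
  rewrite (card_not_sub_index2 sXG iX sHG nsHX).
  by rewrite -[2 in LHS]muln1 eqn_pmul2l // -trivg_card1.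
pose F k := if k == 2 then 1%N else 0%N.
transitivity (\sum_(K in subgroups X) F #|K|)%N.
  rewrite -big_mkcondr sum1dep_card; apply: eq_card => H.
  rewrite !inE [RHS]andbC; apply: andb_id2r => sHX.
  by rewrite (subset_trans sHX sXG).
rewrite (sum_subgroups_cyclic_pgroup _ _ cX oX) // -big_mkcond.
(* The index 1 is in range because [1 < n]. *)
rewrite (big_pred1 (inord 1)) // => k /=.
by rewrite (@eqn_exp2l 2 k 1) // -val_eqE /= inordK // -def_n.
Qed.

Lemma simple_ratio_cyclic_index2 :
  simple_ratio G = ((m%:R + 1) / (n%:R + m%:R + 2 ^+ (n - 1) - 1))%R.
Proof.
rewrite /simple_ratio num_simple_subgroups_cyclic_index2.
rewrite card_subgroups_cyclic_index2 GRing.natrB ?addn_gt0 ?expn_gt0 ?orbT //.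
by rewrite !GRing.natrD GRing.natrX -GRing.natr1 subn1.
Qed.

End CyclicMaximal.

Import GRing.Theory.

(** * The number [m] of outer involutions in each family *)

Section Extremal2.

Local Open Scope group_scope.
Local Open Scope ring_scope.

Lemma simple_ratio_dihedral2 (n : nat) (gT : finGroupType) (G : {group gT}) :
  (2 <= n)%N -> dihedral2 n G ->
  simple_ratio G = (2 ^+ (n - 1) + 1) / (2 ^+ n + n%:R - 1).
Proof.
move=> n_gt1 /(dihedral2P _ n_gt1) isoG.
have [[x y] genG _] := generators_2dihedral n_gt1 isoG.
have [[_ X'2 _] _ _ _ _] := dihedral2_structure n_gt1 genG isoG.
have [oG Gx ox _] := genG.
have sXG : <[x]> \subset G by rewrite cycle_subG.
have X'2E z : z \in G :\: <[x]> -> (z ^+ 2 = 1)%g.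
  by move=> X'z; rewrite -(X'2 z X'z) expg_order.
have X'4 : {in G :\: <[x]>, forall z, z ^+ 4 = 1}%g.
  by move=> z X'z; rewrite (expgM z 2 2) (X'2E z) // expg1n.
rewrite (simple_ratio_cyclic_index2 n_gt1 oG sXG (cycle_cyclic x) ox X'4).
have -> : [set z in G :\: <[x]> | z ^+ 2 == 1]%g = G :\: <[x]>.
  by apply/setP=> z; rewrite inE; apply/andb_idr=> /X'2E/eqP.
have -> : #|G :\: <[x]>| = (2 ^ (n - 1))%N.
  rewrite cardsD (setIidPr sXG) oG [#|<[x]>|]ox -subn1.
  by rewrite -[in (2 ^ n)%N](subnK (ltnW n_gt1)) addn1 expnS mul2n -addnn addnK.
have -> : 2 ^+ n = 2 * 2 ^+ (n - 1) :> rat by rewrite -exprS subn1 prednK // ltnW.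
by rewrite natrX; congr (_ / _); ring.
Qed.

Lemma simple_ratio_quaternion2 (n : nat) (gT : finGroupType) (G : {group gT}) :
  (3 <= n)%N -> quaternion2 n G ->
  simple_ratio G = 1 / (2 ^+ (n - 1) + n%:R - 1).
Proof.
move=> n_gt2 /(quaternion2P _ n_gt2) isoG.
have [[x y] genG _] := generators_quaternion n_gt2 isoG.
have [[_ X'4 _] _ _ _ _] := quaternion_structure n_gt2 genG isoG.
have [oG Gx ox _] := genG.
have sXG : <[x]> \subset G by rewrite cycle_subG.
have X'4E : {in G :\: <[x]>, forall z, z ^+ 4 = 1}%g.
  by move=> z X'z; rewrite -(X'4 z X'z) expg_order.
rewrite (simple_ratio_cyclic_index2 (ltnW n_gt2) oG sXG (cycle_cyclic x) ox X'4E).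
(* Every element outside [<[x]>] has order exactly 4. *)
have -> : [set z in G :\: <[x]> | z ^+ 2 == 1]%g = set0.
  apply/setP=> z; rewrite inE in_set0; apply/negP=> /andP[/X'4 oz].
  by rewrite -order_dvdn oz.
by rewrite cards0 add0r addr0 [n%:R + _]addrC.
Qed.

Lemma simple_ratio_quasidihedral2 (n : nat) (gT : finGroupType)
    (G : {group gT}) :
  (4 <= n)%N -> quasidihedral2 n G ->
  simple_ratio G = (2 ^+ (n - 2) + 1) / (3 * 2 ^+ (n - 2) + n%:R - 1).
Proof.
move=> n_gt3 /(quasidihedral2P _ n_gt3) isoG.
have [[x y] genG [oy xy]] := generators_semidihedral n_gt3 isoG.
have [oG Gx ox X'y] := genG; have n_gt1 : (1 < n)%N by apply: ltnW (ltnW _).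
have sXG : <[x]> \subset G by rewrite cycle_subG.
have [k def_n] : exists k, n = k.+4 by exists (n - 4)%N; rewrite -addn4 subnK.
have iX : #|G : <[x]>| = 2%N.
  by rewrite -divgS // oG [#|_|]ox def_n expnS mulnK ?expn_gt0.
have defX' := rcoset_index2 sXG iX X'y.
have y2 : (y * y = 1)%g by rewrite -(expg_order y) oy.
(* Conjugation by [y] multiplies exponents of [x] by [2 ^ n.-2 - 1], and
   [i + i * (2 ^ n.-2 - 1) = i * 2 ^ n.-2]. *)
have sqr i : ((x ^+ i * y) ^+ 2 = x ^+ (i * 2 ^ n.-2))%g.
  have yV : (y^-1 = y)%g by rewrite invg_expg oy.
  rewrite expgS expg1 mulgA -(mulgA _ y) [(y * _)%g]conjgCV yV conjXg xy.
  rewrite mulgA -(mulgA _ y y) y2 mulg1 -expgM -expgD -mulSn.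
  by rewrite prednK ?expn_gt0 // mulnC.
have X'4 : {in G :\: <[x]>, forall z, z ^+ 4 = 1}%g.
  move=> z; rewrite -defX' => /rcosetP[_ /cycleP[i ->] ->].
  rewrite (expgM _ 2 2) sqr -expgM -mulnA -expnSr.
  have -> : n.-2.+1 = n.-1 by rewrite def_n.
  by rewrite -ox mulnC expgM expg_order expg1n.
rewrite (simple_ratio_cyclic_index2 n_gt1 oG sXG (cycle_cyclic x) ox X'4).
(* As [x] has order [2 ^ n.-1], the square of [x ^+ i * y] is trivial exactly when [i] is even. *)
have -> : [set z in G :\: <[x]> | z ^+ 2 == 1]%g = (<[x ^+ 2]> :* y)%g.
  apply/setP=> z; rewrite inE -defX'; apply/andP/rcosetP.
    case=> /rcosetP[_ /cycleP[i ->] ->]; rewrite sqr -order_dvdn ox.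
    rewrite def_n /= expnS dvdn_pmul2r ?expn_gt0 // => /dvdnP[j ->].
    by exists (x ^+ (j * 2))%g => //; rewrite mulnC expgM mem_cycle.
  case=> _ /cycleP[i ->] ->; rewrite -expgM; split.
    by rewrite mem_rcoset mulgK mem_cycle.
  by rewrite sqr -order_dvdn ox def_n /= expnS mulnAC dvdn_mulr.
have -> : #|(<[x ^+ 2]> :* y)%g| = (2 ^ (n - 2))%N.
  rewrite card_rcoset -[LHS]/#[_]%g orderXdiv ox def_n ?subn2 /= expnS ?mulKn //.
  exact: dvdn_mulr.
rewrite natrX def_n !subSS subn0 (exprS _ k.+2).
by congr (_ / _); ring.
Qed.

End Extremal2.

Local Open Scope ring_scope.

Theorem proposition2p12 :
  (forall (n : nat) (gT : finGroupType) (G : {group gT}),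
     (2 <= n)%N -> dihedral2 n G ->
     simple_ratio G = (2 ^+ (n - 1) + 1) / (2 ^+ n + n%:R - 1))
  /\
  (forall (n : nat) (gT : finGroupType) (G : {group gT}),
     (3 <= n)%N -> quaternion2 n G ->
     simple_ratio G = 1 / (2 ^+ (n - 1) + n%:R - 1))
  /\
  (forall (n : nat) (gT : finGroupType) (G : {group gT}),
     (4 <= n)%N -> quasidihedral2 n G ->
     simple_ratio G = (2 ^+ (n - 2) + 1) / (3 * 2 ^+ (n - 2) + n%:R - 1)).
Proof.
split; [|split] => n gT G.
- exact: simple_ratio_dihedral2.
- exact: simple_ratio_quaternion2.
- exact: simple_ratio_quasidihedral2.
Qed.
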